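(* Let $m,L\in\mathbb{Z}_{>0}$ and let $N\in\mathbb{Z}_{>0}$ satisfy $N\geq(m+1)L-1$. If the sequence $\{u_k\}_{k=0}^{N-1}$, $u_k\in\mathbb{R}^m$, takes the form $$u_k=\begin{cases} e_j, & k=jL-1,\\ \mathbf{0}, & \text{otherwise},\end{cases}$$ where $j$ ranges over $\{1,\dots,m\}$, then $\operatorname{rank}(\mathscr{H}_L(u))=mL$.
   Context: $\mathbb{Z}_{>0}$ is the set of positive integers, and $e_1,\dots,e_m$ are the columns of the $m\times m$ identity matrix. For a sequence $\{z_k\}_{k=0}^{N-1}$ with $z_k\in\mathbb{R}^\eta$ and $0\le l\le j\le N-1$, write $z_{[l,j]}=\begin{bmatrix} z_l^\top & z_{l+1}^\top & \cdots & z_j^\top\end{bmatrix}^\top$. For $1\le L\le N$, the Hankel matrix of depth $L$ is $\mathscr{H}_L(z)=\begin{bmatrix} z_{[0,L-1]} & z_{[1,L]} & \cdots & z_{[N-L,N-1]}\end{bmatrix}\in\mathbb{R}^{\eta L\times(N-L+1)}$. (The sequence is called persistently exciting of order $L$ if $\operatorname{rank}(\mathscr{H}_L(z))=\eta L$.) *)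

(* Defs.v *)
From mathcomp Require Import all_boot all_order all_algebra.

Set Implicit Arguments.
Unset Strict Implicit.
Unset Printing Implicit Defensive.

Import GRing.Theory.
Local Open Scope ring_scope.

(* The stacked vector z_[l, l+L-1]. [mxvec] is row-major, so the L blocks
   z_l, z_(l+1), ... of height eta are stacked in this order: the component a of
   z_(l+i) is at position i * eta + a. *)
Definition window (V : nmodType) (eta N : nat) (L : nat)
    (z : N.-tuple 'cV[V]_eta) (l : nat) : 'cV[V]_(L * eta) :=
  (mxvec (\matrix_(i < L, a < eta) z`_(l + i) a 0))^T.

(* Meaningful for 1 <= L <= N, where every index l + i read by the columns is
   at most N - 1, so that the default value of [nth] is never used. *)
Definition hankel (V : nmodType) (eta N : nat) (L : nat)
    (z : N.-tuple 'cV[V]_eta) : 'M[V]_(L * eta, N - L + 1) :=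
  \matrix_(r, c) window L z c r 0.

Lemma hankelE (V : nmodType) (eta N L : nat) (z : N.-tuple 'cV[V]_eta)
    (i : 'I_L) (a : 'I_eta) (c : 'I_(N - L + 1)) :
  hankel L z (mxvec_index i a) c = z`_(c + i) a 0.
Proof. by rewrite /hankel /window !mxE mxvecE mxE. Qed.

(* Main.v *)
Require Import Defs.
From mathcomp Require Import all_boot all_order all_algebra.
From mathcomp Require Import reals.
From mathcomp Require Import zify.

Set Implicit Arguments.
Unset Strict Implicit.
Unset Printing Implicit Defensive.

Import GRing.Theory.
Local Open Scope ring_scope.

(** The impulses of [u] are [L] steps apart, so that a window of length [L]
    sees at most one of them, and a column of the Hankel matrix whose window
    contains an impulse is a unit vector.  Sliding the window over the [j]-th
    impulse, at time [(j + 1) * L - 1] with [j] counted from [0], puts the 1 of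
    [e_j] in each of the [L] blocks in turn.  Hence every unit vector of height
    [L * m] is a column ([impulse_hankel_column]), the columns span the whole
    space and the rank is full ([mxrank_unit_columns]).  The bound on [N] is
    what leaves room for the last impulse, at time [m * L - 1], to travel up to
    the top block: that window starts at the impulse itself. *)

(** Selecting the unit columns is a right multiplication that yields the
    identity, so such a matrix has a right inverse. *)
Lemma mxrank_unit_columns (F : fieldType) (p q : nat) (A : 'M[F]_(p, q)) :
  (forall r, exists c, forall r', A r' c = (r' == r)%:R) -> \rank A = p.
Proof.
move=> /fin_all_exists[f Af]; apply/eqP/row_freeP; exists (colsub f 1%:M).
by apply/matrixP=> r' r; rewrite mulmx_colsub mulmx1 !mxE Af.
Qed.

Lemma mxvec_index_eq (p q : nat) (i i' : 'I_p) (a a' : 'I_q) :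
  (mxvec_index i' a' == mxvec_index i a) = (i' == i) && (a' == a).
Proof.
rewrite /mxvec_index (inj_eq (@cast_ord_inj _ _ _)) (inj_eq enum_rank_inj).
exact: xpair_eqE.
Qed.

(** The window that starts [i] steps before the impulse of index [a] has that
    impulse in its block [i]; any other block [i'] could only hold an impulse if
    [i'] and [i] were congruent modulo [L]. *)
Lemma impulse_hankel_column (V : pzRingType) (m L N : nat)
  (u : N.-tuple 'cV[V]_m) :
  ((m + 1) * L - 1 <= N)%N ->
  (forall (k : 'I_N) (j : 'I_m),
     nat_of_ord k = (j.+1 * L - 1)%N -> tnth u k = col j 1%:M) ->
  (forall k : 'I_N,
     (forall j : 'I_m, nat_of_ord k <> (j.+1 * L - 1)%N) -> tnth u k = 0) ->
  forall r, exists c, forall r', hankel L u r' c = (r' == r)%:R.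
Proof.
move=> hN u_impulse u_zero r; case/mxvec_indexP: r => i a.
have ltiL := ltn_ord i.
have le_aL : (a.+1 * L <= m * L)%N by rewrite leq_mul2r ltn_ord orbT.
have ge_aL : (L <= a.+1 * L)%N by rewrite leq_pmull.
have ltc : (a.+1 * L - 1 - i < N - L + 1)%N by lia.
exists (Ordinal ltc) => r'; case/mxvec_indexP: r' => i' a'.
have lti'L := ltn_ord i'.
rewrite hankelE mxvec_index_eq /=.
have ltk : (a.+1 * L - 1 - i + i' < N)%N by lia.
rewrite -[(_ + _)%N]/(nat_of_ord (Ordinal ltk)) -tnth_nth.
case: (eqVneq i' i) ltk => [-> | ne_i'i] ltk.
  by rewrite (u_impulse _ a) ?mxE //=; lia.
rewrite u_zero ?mxE // => j /= def_k.
have eq_aj : (a.+1 * L + i' = j.+1 * L + i)%N.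
  have : (L <= j.+1 * L)%N by rewrite leq_pmull.
  by lia.
case/eqP: ne_i'i; apply/val_inj => /=.
by have /(congr1 (modn^~ L)) := eq_aj; rewrite !modnMDl !modn_small.
Qed.

Theorem theorem2 (R : realType) (m L N : nat)
  (hm : (0 < m)%N) (hL : (0 < L)%N) (hN : (0 < N)%N)
  (hNmL : ((m + 1) * L - 1 <= N)%N)
  (u : N.-tuple 'cV[R]_m)
  (u_impulse : forall (k : 'I_N) (j : 'I_m),
     nat_of_ord k = (j.+1 * L - 1)%N -> tnth u k = col j 1%:M)
  (u_zero : forall k : 'I_N,
     (forall j : 'I_m, nat_of_ord k <> (j.+1 * L - 1)%N) -> tnth u k = 0) :
  \rank (hankel L u) = (m * L)%N.
Proof.
by rewrite (mxrank_unit_columns (impulse_hankel_column hNmL u_impulse u_zero)) mulnC.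
Qed.
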